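(* Let $\phi:[0,\infty)\to(0,1]$ be a continuous function monotonically decreasing to zero which decays sub-exponentially fast, i.e. $\frac{\log \phi(n)}{n}\to 0$ as $n\to\infty$. Let $C_\phi=\{\phi(t)e^{it} : t\in[0,\infty)\}\cup\{(0,0)\}\subset\mathbb{R}^2$ be the associated spiral. Then there is no bi-Lipschitz homeomorphism of $\mathbb{R}^2$ which maps $C_\phi$ into an unwinded curve.
   Context: $\mathbb{R}^2$ is identified with $\mathbb{C}$. A map $h:\mathbb{R}^d\to\mathbb{R}^d$ is bi-Lipschitz with constant $L>0$ if $\frac1L\|x-y\|\le\|h(x)-h(y)\|\le L\|x-y\|$ for all $x,y\in\mathbb{R}^d$. For $A\subset\mathbb{R}^d$ and a point $o\in\overline{A}$, the set of asymptotic directions of $A$ at $o$ is $$D(A)=\left\{u\in S^{d-1} : \exists\,(a_n)\subset A\setminus\{o\}\text{ with } a_n\to o \text{ and } \frac{a_n-o}{\|a_n-o\|}\to u\right\}.$$ A curve $C\subset\mathbb{R}^2$ containing zero is called unwinded (around zero) if $D(C)\neq S^1$, where $D(C)$ is taken at $o=0$ and $S^1$ is the unit circle.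
   Formalization: Unwindedness of the target curve is taken at the image h(0) of the spiral's centre instead of at zero; with h(0) ≠ 0 allowed the literal claim is false (φ(t)=1/(1+t), h(z)=z−1 puts the outer endpoint at 0). *)

(* Defs.v *)
From Stdlib Require Import Reals.
From Coquelicot Require Import Coquelicot.
Open Scope R_scope.

(* The plane R^2 is Coquelicot's [C = R * R]; [Cmod] is its
   Euclidean norm, and topological notions use the product structure
   [C_UniformSpace]. *)

Definition bilipschitz (h : C -> C) : Prop :=
  exists L : R, 0 < L /\
    forall x y : C,
      / L * Cmod (x - y)%C <= Cmod (h x - h y)%C <= L * Cmod (x - y)%C.

Definition homeomorphism (h : C -> C) : Prop :=
  exists g : C -> C,
    (forall z, g (h z) = z) /\ (forall z, h (g z) = z) /\
    (forall z, continuous h z) /\ (forall z, continuous g z).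

Definition unit_circle (u : C) : Prop := Cmod u = 1.

Definition asymptotic_directions (A : C -> Prop) (o : C) (u : C) : Prop :=
  unit_circle u /\
  exists a : nat -> C,
    (forall n, A (a n) /\ a n <> o) /\
    filterlim a eventually (locally o) /\
    filterlim (fun n => ((a n - o) / RtoC (Cmod (a n - o)))%C)
      eventually (locally u).

Definition interval (I : R -> Prop) : Prop :=
  forall a b x, I a -> I b -> a <= x <= b -> I x.

(* Neither compactness of the parameter interval nor injectivity of the
   parametrization is required. *)
Definition curve (A : C -> Prop) : Prop :=
  exists (I : R -> Prop) (gamma : R -> C),
    interval I /\ continuous_on I gamma /\
    forall z, A z <-> exists t, I t /\ gamma t = z.

(* "Unwinded around zero" is [unwinded_around 0 A]. *)
Definition unwinded_around (o : C) (A : C -> Prop) : Prop :=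
  curve A /\ A o /\
  ~ (forall u, asymptotic_directions A o u <-> unit_circle u).

Definition spiral (phi : R -> R) (z : C) : Prop :=
  (exists t, 0 <= t /\ z = (phi t * cos t, phi t * sin t)) \/ z = (0, 0).

(* Main.v *)
Require Import Defs.
From Stdlib Require Import Reals Lra Lia ClassicalEpsilon Ranalysis5.
From Coquelicot Require Import Coquelicot.
Open Scope R_scope.

(** Suppose the image of the spiral misses a sector at [h 0].  Sub-exponential
    decay gives arbitrarily large [t] for which the turn of the spiral over
    [[t, t + 2 PI]] is almost closed, at scale [phi t].  Inside the slit plane
    its image contracts along straight lines to a point on the missing ray,
    staying at distance comparable to [phi t] from [h 0]; [h]^-1 carries this
    to a deformation of the turn in the punctured plane that keeps the
    endpoints close.  The total angle would go continuously from [2 PI] to [0],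
    hence pass through [PI], where the endpoints are opposite and thus far
    apart. *)

(** * Oriented angles and the total turn of a chain of points *)

Definition dot (z w : C) : R := fst z * fst w + snd z * snd w.

Definition cross (z w : C) : R := fst z * snd w - snd z * fst w.

Definition polar (a : R) : C := (cos a, sin a).

(* The oriented angle from [z] to [w], meaningful only when [0 < dot z w]. *)
Definition turn (z w : C) : R := atan (cross z w / dot z w).

Fixpoint total_turn (p : nat -> C) (n : nat) : R :=
  match n with
  | O => 0
  | S k => total_turn p k + turn (p k) (p (S k))
  end.

Lemma Cmod_sqr (z : C) : Cmod z ^ 2 = dot z z.
Proof.
  unfold Cmod, dot. rewrite <- Rsqr_pow2, Rsqr_sqrt by nra. ring.
Qed.

(** Expanding the square, [Cmod (w - z) ^ 2] is [dot z z + dot w w - 2 * dot z w]; below [dot z z]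
    it forces [2 * dot z w > dot w w >= 0]. *)
Lemma dot_pos_of_near (z w : C) : Cmod (w - z) < Cmod z -> 0 < dot z w.
Proof.
  intros H.
  assert (Hs : Cmod (w - z) ^ 2 < Cmod z ^ 2).
  { pose proof (Cmod_ge_0 (w - z)). nra. }
  rewrite !Cmod_sqr in Hs. destruct z as [x y], w as [x' y'].
  unfold dot in *; simpl in *. nra.
Qed.

(** The quotient [w / z] has real part [dot z w / dot z z] and imaginary part [cross z w / dot z z];
    in the right half-plane [atan] of their ratio is the argument. *)
Lemma turn_spec (z w : C) :
  0 < dot z w ->
  exists rho : R, 0 < rho /\ w = (RtoC rho * polar (turn z w) * z)%C.
Proof.
  intros Hd.
  assert (Hz : 0 < dot z z).
  { destruct z as [x y], w as [x' y']; unfold dot in *; simpl in *.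
    destruct (Req_dec x 0) as [->|]; destruct (Req_dec y 0) as [->|]; nra. }
  set (d := dot z w) in *. set (c := cross z w).
  set (k := sqrt (1 + (c / d)²)).
  assert (Hk : 0 < k).
  { apply sqrt_lt_R0. pose proof (Rle_0_sqr (c / d)). lra. }
  (* By Lagrange's identity [d * k] is the product of the two moduli, so this witness is
     [Cmod w / Cmod z]. *)
  exists (d * k / dot z z). split.
  { apply Rdiv_lt_0_compat; nra. }
  unfold polar, turn. fold c d. rewrite cos_atan, sin_atan. fold k.
  subst c. revert Hz Hd. subst d.
  clearbody k. destruct z as [x y], w as [x' y'].
  unfold dot, cross, Cmult; simpl; intros Hz Hd.
  f_equal; field; repeat split; lra.
Qed.

Lemma polar_plus (a b : R) : polar (a + b) = (polar a * polar b)%C.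
Proof.
  unfold polar, Cmult; simpl. rewrite cos_plus, sin_plus. f_equal; ring.
Qed.

(** Ratios multiply and angles add along the chain. Nothing is reduced modulo [2 * PI], so
    [total_turn] is a discrete lift of the argument. *)
Lemma total_turn_spec (p : nat -> C) (n : nat) :
  (forall i, (i < n)%nat -> 0 < dot (p i) (p (S i))) ->
  exists rho : R, 0 < rho /\ p n = (RtoC rho * polar (total_turn p n) * p O)%C.
Proof.
  induction n as [|n IH]; intros H.
  - exists 1. split; [lra|]. simpl. unfold polar. rewrite cos_0, sin_0.
    change (1, 0) with (RtoC 1). ring.
  - destruct IH as [r [Hr Er]]; [intros; apply H; lia|].
    destruct (turn_spec _ _ (H n (Nat.lt_succ_diag_r n))) as [s [Hs Es]].
    exists (s * r). split; [nra|].
    rewrite Es. simpl total_turn. rewrite polar_plus, RtoC_mult.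
    rewrite Er at 2. ring.
Qed.

Lemma total_turn_continuous (G : R -> nat -> C) (n : nat) (s : R) :
  (forall i, continuity_pt (fun r => fst (G r i)) s) ->
  (forall i, continuity_pt (fun r => snd (G r i)) s) ->
  (forall i, (i < n)%nat -> 0 < dot (G s i) (G s (S i))) ->
  continuity_pt (fun r => total_turn (G r) n) s.
Proof.
  intros Hx Hy. induction n as [|n IH]; intros H.
  - apply continuity_pt_const. intros a b; reflexivity.
  - simpl. apply (continuity_pt_plus (fun r => total_turn (G r) n)
                    (fun r => turn (G r n) (G r (S n)))).
    + apply IH; intros; apply H; lia.
    + unfold turn.
      apply (continuity_pt_comp
               (fun r => cross (G r n) (G r (S n)) / dot (G r n) (G r (S n))) atan).
      * apply (continuity_pt_div (fun r => cross (G r n) (G r (S n)))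
                 (fun r => dot (G r n) (G r (S n)))).
        -- apply (continuity_pt_minus (fun r => fst (G r n) * snd (G r (S n)))
                    (fun r => snd (G r n) * fst (G r (S n))));
             apply continuity_pt_mult with (f1 := fun r => _) (f2 := fun r => _); auto.
        -- apply (continuity_pt_plus (fun r => fst (G r n) * fst (G r (S n)))
                    (fun r => snd (G r n) * snd (G r (S n))));
             apply continuity_pt_mult with (f1 := fun r => _) (f2 := fun r => _); auto.
        -- specialize (H n (Nat.lt_succ_diag_r n)). lra.
      * apply derivable_continuous_pt, derivable_pt_atan.
Qed.

(* Along the deformation the total turn drops continuously from [2 * PI] to
   [0]; where it equals [PI] the endpoints of the chain point in opposite
   directions. *)
Lemma endpoints_apart (G : R -> nat -> C) (n : nat) :
  (forall i s, 0 <= s <= 1 -> continuity_pt (fun r => fst (G r i)) s) ->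
  (forall i s, 0 <= s <= 1 -> continuity_pt (fun r => snd (G r i)) s) ->
  (forall i s, 0 <= s <= 1 -> (i < n)%nat ->
     Cmod (G s (S i) - G s i) < Cmod (G s i)) ->
  total_turn (G 0) n = 2 * PI -> total_turn (G 1) n = 0 ->
  exists s, 0 <= s <= 1 /\ Cmod (G s O) <= Cmod (G s n - G s O).
Proof.
  intros Hx Hy Hstep H0 H1.
  pose proof PI_RGT_0 as Hpi.
  assert (Hdot : forall s, 0 <= s <= 1 -> forall i, (i < n)%nat ->
                   0 < dot (G s i) (G s (S i))).
  { intros s Hs i Hi. apply dot_pos_of_near. auto. }
  (* The sign is flipped because [IVT_interv] wants a function going from negative to positive
     values. *)
  destruct (IVT_interv (fun s => PI - total_turn (G s) n) 0 1) as [s [Hs E]].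
  - intros s Hs.
    apply (continuity_pt_minus (fun _ => PI) (fun r => total_turn (G r) n)).
    + apply continuity_pt_const. intros a b; reflexivity.
    + apply total_turn_continuous; auto.
  - lra.
  - rewrite H0. lra.
  - rewrite H1. lra.
  - exists s. split; [exact Hs|].
    destruct (total_turn_spec (G s) n (Hdot s Hs)) as [rho [Hr Er]].
    replace (total_turn (G s) n) with PI in Er by lra.
    rewrite Er. unfold polar. rewrite cos_PI, sin_PI.
    (* Opposite directions: the last point is [- rho] times the first, so their distance is
       [1 + rho] times the modulus of the first. *)
    replace (RtoC rho * (-1, 0) * G s 0%nat - G s 0%nat)%C
      with (RtoC (- (1 + rho)) * G s 0%nat)%C
      by (unfold RtoC, Cmult, Cminus, Cplus, Copp; simpl; f_equal; ring).
    rewrite Cmod_mult, Cmod_R, Rabs_Ropp, Rabs_pos_eq by lra.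
    pose proof (Cmod_ge_0 (G s O)). nra.
Qed.

(** * The missing sector and the slow decay *)

Lemma sector_escape (A : C -> Prop) (o u : C) :
  unit_circle u -> ~ asymptotic_directions A o u ->
  exists eps : R, 0 < eps /\
    forall a, A a -> a <> o -> Cmod (a - o) < eps ->
      eps <= Cmod ((a - o) / RtoC (Cmod (a - o)) - u).
Proof.
  intros Hu Hn. apply NNPP. intros Hc. apply Hn. split; [exact Hu|].
  (* If no [eps] works, each [/ INR (S n)] fails as both radius and sector width; the
     counterexamples form a sequence realizing the direction [u]. *)
  assert (Hex : forall n : nat, exists a, (A a /\ a <> o) /\
            Cmod (a - o) < / INR (S n) /\
            Cmod ((a - o) / RtoC (Cmod (a - o)) - u) < / INR (S n)).
  { intros n. apply NNPP. intros Ha. apply Hc. exists (/ INR (S n)).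
    split; [apply Rinv_0_lt_compat, lt_0_INR; lia|].
    intros a H1 H2 H3. apply Rnot_lt_le. intros H4. apply Ha. exists a. tauto. }
  pose (a := fun n => proj1_sig (constructive_indefinite_description _ (Hex n))).
  assert (Ha : forall n, (A (a n) /\ a n <> o) /\
            Cmod (a n - o) < / INR (S n) /\
            Cmod ((a n - o) / RtoC (Cmod (a n - o)) - u) < / INR (S n)).
  { intros n. unfold a. apply proj2_sig. }
  assert (Hlim : forall (b : nat -> C) (l : C),
            (forall n, Cmod (b n - l) < / INR (S n)) ->
            filterlim b eventually (locally l)).
  { intros b l Hb. apply filterlim_locally. intros eps.
    destruct (archimed_cor1 eps (cond_pos eps)) as [N [HN HN0]].
    exists N. intros n Hle. apply C_NormedModule_mixin_compat1.
    eapply Rlt_trans; [apply (Hb n)|].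
    eapply Rle_lt_trans; [|exact HN].
    apply Rinv_le_contravar; [apply lt_0_INR; lia|apply le_INR; lia]. }
  exists a. split; [intros n; apply Ha|].
  split; apply Hlim; intros n; apply Ha.
Qed.

(* With [x] the direction of [w], both [A * (x - u)] and [b * (x - u)] differ
   from [A * x - b * u] by a vector of length [Rabs (A - b)]. *)
Lemma avoided_sector_lower_bound (u w : C) (eps a b : R) :
  Cmod u = 1 -> w <> RtoC 0 -> 0 <= a -> 0 <= b ->
  eps <= Cmod (w / RtoC (Cmod w) - u) ->
  eps * (a * Cmod w + b) <= 4 * Cmod (RtoC a * w - RtoC b * u).
Proof.
  intros Hu Hw Ha Hb He.
  assert (Hm : 0 < Cmod w) by (apply Cmod_gt_0; exact Hw).
  assert (Hm0 : RtoC (Cmod w) <> RtoC 0) by (intros E; apply RtoC_inj in E; lra).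
  set (x := (w / RtoC (Cmod w))%C) in *.
  assert (Hx : Cmod x = 1).
  { unfold x. rewrite Cmod_div, Cmod_R, Rabs_pos_eq by (assumption || lra). field; lra. }
  set (A := a * Cmod w).
  assert (HA : 0 <= A) by (unfold A; nra).
  replace (RtoC a * w)%C with (RtoC A * x)%C
    by (unfold A, x; rewrite RtoC_mult; field; exact Hm0).
  clearbody A x.
  set (X := (RtoC A * x - RtoC b * u)%C).
  assert (Hscale : forall c (z v : C), 0 <= c -> Cmod v = 1 ->
            (RtoC c * z = X + - (RtoC (A - b) * v))%C ->
            c * Cmod z <= Cmod X + Rabs (A - b)).
  { intros c z v Hc Hv E.
    rewrite <- (Rabs_pos_eq c Hc), <- Cmod_R, <- Cmod_mult, E.
    eapply Rle_trans; [apply Cmod_triangle|].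
    rewrite Cmod_opp, Cmod_mult, Cmod_R, Hv. lra. }
  assert (T1 : A * Cmod (x - u) <= Cmod X + Rabs (A - b)).
  { apply (Hscale A _ u HA Hu). unfold X. rewrite RtoC_minus. ring. }
  assert (T2 : b * Cmod (x - u) <= Cmod X + Rabs (A - b)).
  { apply (Hscale b _ x Hb Hx). unfold X. rewrite RtoC_minus. ring. }
  assert (T3 : Rabs (A - b) <= Cmod X).
  { assert (U1 : Cmod (RtoC A * x) <= Cmod X + Cmod (RtoC b * u)).
    { replace (RtoC A * x)%C with (X + RtoC b * u)%C by (unfold X; ring).
      apply Cmod_triangle. }
    assert (U2 : Cmod (RtoC b * u) <= Cmod X + Cmod (RtoC A * x)).
    { rewrite <- (Cmod_opp X).
      replace (RtoC b * u)%C with (- X + RtoC A * x)%C by (unfold X; ring).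
      apply Cmod_triangle. }
    rewrite !Cmod_mult, !Cmod_R, Hu, Hx, (Rabs_pos_eq A), (Rabs_pos_eq b) in U1, U2 by assumption.
    apply Rabs_le. lra. }
  (* Adding [T1] and [T2] and bounding [Rabs (A - b)] by [T3] gives
     [(A + b) * Cmod (x - u) <= 4 * Cmod X]. *)
  nra.
Qed.

(** Otherwise [phi] would lose a factor [1 - eta] on every step of length 8 from [T] on, which is
    exponential decay. The length 8 covers a full turn, since [PI <= 4], and as an integer it keeps
    the steps on the points where the limit is sampled. *)
Lemma slow_decay (phi : R -> R) (T : nat) (eta : R) :
  (forall t, 0 <= t -> 0 < phi t <= 1) ->
  is_lim_seq (fun n => ln (phi (INR n)) / INR n) 0 ->
  0 < eta < 1 ->
  exists t, INR T <= t /\ (1 - eta) * phi t <= phi (t + 8).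
Proof.
  intros Hphi Hlim Heta. apply NNPP. intros Hc.
  assert (Hstep : forall t, INR T <= t -> phi (t + 8) < (1 - eta) * phi t).
  { intros t Ht. apply Rnot_le_lt. intros H. apply Hc. exists t. tauto. }
  assert (Hln : ln (1 - eta) < 0) by (rewrite <- ln_1; apply ln_increasing; lra).
  assert (Hk : forall k, ln (phi (INR (T + 8 * k))) <= INR k * ln (1 - eta)).
  { induction k as [|k IH].
    - rewrite Rmult_0_l. rewrite <- ln_1.
      destruct (Hphi (INR (T + 8 * 0)) (pos_INR _)). apply ln_le; assumption.
    - replace (INR (T + 8 * S k)) with (INR (T + 8 * k) + 8)
        by (replace (T + 8 * S k)%nat with (T + 8 * k + 8)%nat by lia;
            rewrite (plus_INR _ 8); simpl; ring).
      assert (Hp := Hphi (INR (T + 8 * k)) (pos_INR _)).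
      assert (Hq := Hphi (INR (T + 8 * k) + 8) ltac:(pose proof (pos_INR (T + 8 * k)); lra)).
      apply Rle_trans with (ln ((1 - eta) * phi (INR (T + 8 * k)))).
      + apply ln_le; [lra|]. left. apply Hstep. apply le_INR. lia.
      + rewrite ln_mult, S_INR by lra. lra. }
  apply is_lim_seq_spec in Hlim.
  (* The 9 absorbs the offset: once [k > T], the index [T + 8 * k] is at most [9 * k]. *)
  destruct (Hlim (mkposreal (- ln (1 - eta) / 9) ltac:(lra))) as [N HN].
  set (k := (S (T + N))%nat).
  specialize (HN (T + 8 * k)%nat ltac:(unfold k; lia)). cbn [pos] in HN.
  rewrite Rminus_0_r in HN.
  specialize (Hk k). apply Rabs_def2 in HN. destruct HN as [_ HN].
  assert (Hn : 0 < INR (T + 8 * k)) by (apply lt_0_INR; unfold k; lia).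
  assert (Hn9 : INR (T + 8 * k) <= 9 * INR k).
  { replace 9 with (INR 9) by (simpl; ring). rewrite <- mult_INR. apply le_INR. unfold k; lia. }
  set (n := INR (T + 8 * k)) in *.
  apply (Rmult_lt_compat_r n) in HN; [|exact Hn].
  replace (ln (phi n) / n * n) with (ln (phi n)) in HN by (field; lra).
  nra.
Qed.

(** * Turns along the spiral *)

Definition spiral_point (phi : R -> R) (t : R) : C :=
  (phi t * cos t, phi t * sin t).

Lemma spiral_point_polar (phi : R -> R) (t : R) :
  spiral_point phi t = (RtoC (phi t) * polar t)%C.
Proof. unfold spiral_point, polar, RtoC, Cmult; simpl. f_equal; ring. Qed.

Lemma Cmod_polar (t : R) : Cmod (polar t) = 1.
Proof.
  unfold Cmod, polar; simpl fst; simpl snd.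
  replace (cos t ^ 2 + sin t ^ 2) with 1 by (pose proof (sin2_cos2 t); unfold Rsqr in *; nra).
  apply sqrt_1.
Qed.

Lemma Cmod_spiral_point (phi : R -> R) (t : R) :
  0 <= phi t -> Cmod (spiral_point phi t) = phi t.
Proof.
  intros H. rewrite spiral_point_polar, Cmod_mult, Cmod_R, Cmod_polar, Rabs_pos_eq; lra.
Qed.

(** The positive radii cancel in [cross / dot], leaving [tan (t - s)], which [atan] inverts on this
    range. *)
Lemma turn_spiral_point (phi : R -> R) (s t : R) :
  0 < phi s -> 0 < phi t -> - (PI / 2) < t - s < PI / 2 ->
  turn (spiral_point phi s) (spiral_point phi t) = t - s.
Proof.
  intros Hs Ht Hd. unfold turn. rewrite <- (atan_tan (t - s)) by exact Hd.
  f_equal. unfold tan. rewrite cos_minus, sin_minus.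
  assert (Hc : 0 < cos (t - s)) by (apply cos_gt_0; lra).
  rewrite cos_minus in Hc.
  unfold cross, dot, spiral_point; simpl. field. split; [lra|].
  replace (phi s * cos s * (phi t * cos t) + phi s * sin s * (phi t * sin t))
    with (phi s * phi t * (cos t * cos s + sin t * sin s)) by ring.
  apply Rgt_not_eq. repeat apply Rmult_lt_0_compat; assumption.
Qed.

Lemma total_turn_spiral (phi : R -> R) (t d : R) (p : nat -> C) (n : nat) :
  0 < d < PI / 2 -> (forall s, t <= s -> 0 < phi s) ->
  (forall i, p i = spiral_point phi (t + INR i * d)) ->
  total_turn p n = INR n * d.
Proof.
  intros Hd Hphi Hp. induction n as [|n IH]; [simpl; ring|].
  simpl total_turn. rewrite IH, !Hp, S_INR.
  assert (0 <= INR n) by apply pos_INR.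
  rewrite turn_spiral_point; [ring| | |]; try (apply Hphi; nra).
  lra.
Qed.

Lemma total_turn_const (p : nat -> C) (n : nat) :
  (forall i j, p i = p j) -> total_turn p n = 0.
Proof.
  intros H. induction n as [|n IH]; [reflexivity|].
  simpl. rewrite IH, (H (S n) n). unfold turn, cross.
  replace (fst (p n) * snd (p n) - snd (p n) * fst (p n)) with 0 by ring.
  unfold Rdiv. rewrite Rmult_0_l, atan_0. ring.
Qed.

(** * Coordinates and continuity estimates *)

Lemma Cmod_fst (z : C) : Rabs (fst z) <= Cmod z.
Proof. eapply Rle_trans; [apply Rmax_l|apply Rmax_Cmod]. Qed.

Lemma Cmod_snd (z : C) : Rabs (snd z) <= Cmod z.
Proof. eapply Rle_trans; [apply Rmax_r|apply Rmax_Cmod]. Qed.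

Lemma lipschitz_continuity_pt (f : R -> R) (K s : R) :
  (forall r, Rabs (f r - f s) <= K * Rabs (r - s)) -> continuity_pt f s.
Proof.
  intros H eps He. exists (eps / (Rabs K + 1)).
  assert (0 <= Rabs K) by apply Rabs_pos.
  split; [apply Rdiv_lt_0_compat; lra|].
  simpl. unfold R_dist. intros r [_ Hr].
  eapply Rle_lt_trans; [apply H|].
  pose proof (Rle_abs K). pose proof (Rabs_pos (r - s)).
  apply Rle_lt_trans with ((Rabs K + 1) * Rabs (r - s)); [nra|].
  apply (Rmult_lt_compat_l (Rabs K + 1)) in Hr; [|lra].
  replace ((Rabs K + 1) * (eps / (Rabs K + 1))) with eps in Hr by (field; lra).
  exact Hr.
Qed.

Lemma Cmod_lipschitz_components (G : R -> C) (K s : R) :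
  (forall r, Cmod (G r - G s) <= K * Rabs (r - s)) ->
  continuity_pt (fun r => fst (G r)) s /\ continuity_pt (fun r => snd (G r)) s.
Proof.
  intros H. split; apply lipschitz_continuity_pt with K; intros r;
    (eapply Rle_trans; [|apply H]).
  - apply (Cmod_fst (G r - G s)).
  - apply (Cmod_snd (G r - G s)).
Qed.

Lemma spiral_point_uniformly_continuous (phi : R -> R) (a b : R) :
  a < b -> (forall x, a <= x <= b -> continuity_pt phi x) ->
  forall eps, 0 < eps -> exists delta, 0 < delta /\
    forall s t, a <= s <= b -> a <= t <= b -> Rabs (s - t) < delta ->
      Cmod (spiral_point phi s - spiral_point phi t) < eps.
Proof.
  intros Hab Hc eps He.
  assert (He2 : 0 < eps / 2) by lra.
  assert (Hcomp : forall f : R -> R, continuity f ->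
            forall x, a <= x <= b -> continuity_pt (fun y => phi y * f y) x).
  { intros f Hf x Hx. apply (continuity_pt_mult phi f); auto. }
  destruct (Heine_cor1 Hab (Hcomp cos continuity_cos) (mkposreal _ He2))
    as [d1 [_ H1]].
  destruct (Heine_cor1 Hab (Hcomp sin continuity_sin) (mkposreal _ He2))
    as [d2 [_ H2]].
  exists (Rmin d1 d2).
  split; [apply Rmin_case; apply cond_pos|].
  intros s t Hs Ht Hd.
  specialize (H1 s t Hs Ht (Rlt_le_trans _ _ _ Hd (Rmin_l _ _))).
  specialize (H2 s t Hs Ht (Rlt_le_trans _ _ _ Hd (Rmin_r _ _))).
  simpl in H1, H2.
  (* The modulus is at most [sqrt 2 < 2] times the larger coordinate, hence the choice of [eps / 2]
     for each coordinate. *)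
  assert (Hle := Cmod_2Rmax (spiral_point phi s - spiral_point phi t)).
  simpl in Hle.
  eapply Rle_lt_trans; [exact Hle|].
  assert (sqrt 2 < 2).
  { rewrite <- (sqrt_pow2 2) at 2 by lra. apply sqrt_lt_1; lra. }
  assert (0 < sqrt 2) by (apply sqrt_lt_R0; lra).
  change (phi s * cos s + - (phi t * cos t)) with (phi s * cos s - phi t * cos t).
  change (phi s * sin s + - (phi t * sin t)) with (phi s * sin s - phi t * sin t).
  assert (Rmax (Rabs (phi s * cos s - phi t * cos t))
               (Rabs (phi s * sin s - phi t * sin t)) < eps / 2)
    by (apply Rmax_lub_lt; assumption).
  assert (0 <= Rmax (Rabs (phi s * cos s - phi t * cos t))
               (Rabs (phi s * sin s - phi t * sin t)))
    by (eapply Rle_trans; [apply Rabs_pos|apply Rmax_l]).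
  nra.
Qed.

(** * Deforming one turn of the spiral *)

Theorem theorem1p2 :
  forall phi : R -> R,
    (forall t, 0 <= t -> 0 < phi t <= 1) ->
    continuous_on (fun t => 0 <= t) phi ->
    (forall s t, 0 <= s -> s <= t -> phi t <= phi s) ->
    is_lim phi p_infty 0 ->
    is_lim_seq (fun n => ln (phi (INR n)) / INR n) 0 ->
    ~ exists h : C -> C,
        bilipschitz h /\ homeomorphism h /\
        exists A : C -> Prop,
          unwinded_around (h (RtoC 0)) A /\
          (forall z, spiral phi z -> A (h z)).
Proof.
  intros phi Hphi Hcont Hmono Hzero Hlim
    [h [[L [HL Hbi]] [[g [Hgh [Hhg _]]] [A [[_ [_ Hdir]] Hsp]]]]].
  set (o := h (RtoC 0)) in *.
  apply not_all_ex_not in Hdir. destruct Hdir as [u Hu].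
  assert (Hu1 : Cmod u = 1).
  (* Off the unit circle both sides of the equivalence are false, so it could not fail at [u]. *)
  { apply NNPP. intros Hn. apply Hu.
    split; [intros [H _]; exact H|intros H; contradiction]. }
  destruct (sector_escape A o u Hu1) as [eps [Heps Hsec]].
  { intros Hd. apply Hu. tauto. }
  pose proof PI_RGT_0 as Hpi. pose proof PI_4 as Hpi4.
  assert (HLi : 0 < / L) by (apply Rinv_0_lt_compat; exact HL).
  assert (Hexp : forall x y, Cmod (x - y) <= L * Cmod (h x - h y)).
  { intros x y. destruct (Hbi x y) as [H _].
    apply (Rmult_le_compat_l L) in H; [|lra].
    replace (L * (/ L * Cmod (x - y))) with (Cmod (x - y)) in H by (field; lra).
    exact H. }
  assert (Hg : forall x y, Cmod (g x - g y) <= L * Cmod (x - y)).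
  { intros x y. rewrite <- (Hhg x) at 2. rewrite <- (Hhg y) at 2. apply Hexp. }
  (* The bound [1 / 2] keeps [phi] above [r / 2] on the turn; the other makes the endpoint gap,
     magnified by [L ^ 2], at most [c / 2] for the [c] below. *)
  set (eta := Rmin (1 / 2) (eps / (16 * L ^ 4))).
  assert (HL4 : 0 < L ^ 4) by (apply pow_lt; exact HL).
  assert (Heta : 0 < eta <= 1 / 2).
  { split; [apply Rmin_case; [lra|apply Rdiv_lt_0_compat; lra]|apply Rmin_l]. }
  assert (Heta' : eta * (16 * L ^ 4) <= eps).
  { assert (H := Rmin_r (1 / 2) (eps / (16 * L ^ 4))). fold eta in H.
    apply (Rmult_le_compat_r (16 * L ^ 4)) in H; [|lra].
    replace (eps / (16 * L ^ 4) * (16 * L ^ 4)) with eps in H by (field; lra).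
    exact H. }
  apply is_lim_spec in Hzero.
  assert (HeL : 0 < eps / L) by (apply Rdiv_lt_0_compat; lra).
  destruct (Hzero (mkposreal _ HeL)) as [M HM]. simpl in HM.
  (* Starting beyond [M] puts the image of the turn within [eps] of [o], where the sector is
     avoided. *)
  destruct (nfloor_ex (Rmax M 1)) as [T [_ HT]].
  { eapply Rle_trans; [|apply Rmax_r]. lra. }
  destruct (slow_decay phi (S T) eta Hphi Hlim ltac:(lra)) as [t [Ht Hslow]].
  rewrite S_INR in Ht.
  assert (Ht1 : 1 < t) by (pose proof (Rmax_r M 1); lra).
  assert (HtM : M < t) by (pose proof (Rmax_l M 1); lra).
  set (r := phi t) in *.
  assert (Hr : 0 < r) by (apply Hphi; lra).
  assert (HrL : L * r < eps).
  { specialize (HM t HtM). fold r in HM.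
    rewrite Rminus_0_r, Rabs_pos_eq in HM by lra.
    apply (Rmult_lt_compat_l L) in HM; [|exact HL].
    replace (L * (eps / L)) with eps in HM by (field; lra). exact HM. }
  assert (Hturn : forall x, t <= x <= t + 2 * PI ->
            (1 - eta) * r <= phi x <= r).
  { intros x Hx. split; [|apply Hmono; lra].
    eapply Rle_trans; [exact Hslow|]. apply Hmono; lra. }
  assert (Hpc : forall x, t <= x <= t + 2 * PI -> continuity_pt phi x).
  { intros x Hx. apply continuity_pt_filterlim.
    apply (continuous_continuous_on (fun t => 0 <= t)); [|exact Hcont].
    assert (Hx0 : 0 < x) by lra.
    (* The ball of radius [x] about [x] stays in the domain, so relative continuity is two-sided
       there. *)
    exists (mkposreal x Hx0). intros y Hy. apply Rabs_def2 in Hy.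
    change (y - x < x /\ - x < y - x) in Hy. lra. }
  (* This is [eps * m / (4 * L)] with [m = r / (2 * L)]: the distance kept from the origin during
     the deformation. *)
  set (c := eps * r / (8 * L ^ 2)).
  assert (HL2 : 0 < L ^ 2) by (apply pow_lt; exact HL).
  assert (Hc : 0 < c) by (apply Rdiv_lt_0_compat; nra).
  destruct (spiral_point_uniformly_continuous phi t (t + 2 * PI) ltac:(lra) Hpc
              (c / L ^ 2) ltac:(apply Rdiv_lt_0_compat; lra)) as [delta [Hdelta Huc]].
  assert (Hmesh : 0 < Rmin delta (PI / 2) / (2 * PI)).
  { apply Rdiv_lt_0_compat; [apply Rmin_case|]; lra. }
  destruct (archimed_cor1 _ Hmesh) as [N [HN HN0]].
  assert (HNpos : 0 < INR N) by (apply lt_0_INR; exact HN0).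
  (* The [N] steps make exactly one turn; [d < delta] controls chord lengths and [d < PI / 2] lets
     [turn] read off each angle. *)
  set (d := 2 * PI / INR N).
  assert (Hd : 0 < d) by (apply Rdiv_lt_0_compat; lra).
  assert (HNd : INR N * d = 2 * PI) by (unfold d; field; lra).
  assert (Hdm : d < Rmin delta (PI / 2)).
  { apply (Rmult_lt_compat_l (2 * PI)) in HN; [|lra].
    replace (2 * PI * (Rmin delta (PI / 2) / (2 * PI)))
      with (Rmin delta (PI / 2)) in HN by (field; lra).
    exact HN. }
  assert (Hdd := Rlt_le_trans _ _ _ Hdm (Rmin_l _ _)).
  assert (Hdp := Rlt_le_trans _ _ _ Hdm (Rmin_r _ _)).
  set (tau := fun i : nat => t + INR i * d).
  assert (Htau : forall i, (i <= N)%nat -> t <= tau i <= t + 2 * PI).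
  { intros i Hi. apply le_INR in Hi. pose proof (pos_INR i). unfold tau. nra. }
  set (gamma := fun i => spiral_point phi (tau i)).
  set (m := r / (2 * L)).
  assert (Hm : 0 < m) by (apply Rdiv_lt_0_compat; lra).
  (* Straight-line contraction, relative to [o], towards [- m * u]. This target lies opposite the
     missing direction [u], and the plane slit along the ray of [u] is star-shaped about it. *)
  set (H := fun s i => (RtoC (1 - s) * (h (gamma i) - o) - RtoC (s * m) * u)%C).
  set (G := fun s i => g (H s i + o)%C).
  assert (Hw : forall i, (i <= N)%nat ->
            h (gamma i) <> o /\ m <= Cmod (h (gamma i) - o) <= L * r).
  { intros i Hi. destruct (Hturn _ (Htau i Hi)) as [B1 B2].
    destruct (Hbi (gamma i) (RtoC 0)) as [C1 C2]. fold o in C1, C2.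
    replace (gamma i - RtoC 0)%C with (gamma i) in C1, C2 by ring.
    unfold gamma at 1 in C1. unfold gamma at 2 in C2.
    rewrite Cmod_spiral_point in C1, C2 by nra.
    assert (D1 : m <= Cmod (h (gamma i) - o)).
    { eapply Rle_trans; [|exact C1]. unfold m.
      replace (r / (2 * L)) with (/ L * (r / 2)) by (field; apply Rgt_not_eq; exact HL).
      apply Rmult_le_compat_l; nra. }
    split; [|split; [exact D1|nra]].
    intros E. rewrite E in D1. replace (o - o)%C with (RtoC 0) in D1 by ring.
    rewrite Cmod_0 in D1. lra. }
  assert (Hlow : forall s i, 0 <= s <= 1 -> (i <= N)%nat -> c <= Cmod (G s i)).
  { intros s i Hs Hi. destruct (Hw i Hi) as [W0 [W1 W2]].
    assert (Hav : eps * ((1 - s) * Cmod (h (gamma i) - o) + s * m) <= 4 * Cmod (H s i)).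
    { apply avoided_sector_lower_bound; try assumption; try nra.
      - intros E. apply W0. replace (h (gamma i)) with ((h (gamma i) - o) + o)%C by ring.
        rewrite E. ring.
      - apply Hsec; [|exact W0|lra].
        apply Hsp. left. exists (tau i). split; [|reflexivity].
        destruct (Htau i Hi). lra. }
    destruct (Hbi (G s i) (RtoC 0)) as [_ C2]. fold o in C2.
    unfold G at 1 in C2. rewrite Hhg in C2.
    replace (H s i + o - o)%C with (H s i) in C2 by ring.
    replace (G s i - RtoC 0)%C with (G s i) in C2 by ring.
    (* Both the image point's distance to [o] and [m] are at least [m], hence so is their convex
       combination. *)
    assert (E1 : eps * m <= 4 * (L * Cmod (G s i))).
    { apply Rle_trans with (eps * ((1 - s) * Cmod (h (gamma i) - o) + s * m)); [|lra].
      apply Rmult_le_compat_l; [lra|]. nra. }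
    apply Rmult_le_reg_l with (4 * L); [lra|].
    replace (4 * L * c) with (eps * m) by (unfold c, m; field; lra). lra. }
  assert (Hdiff : forall s i j, 0 <= s <= 1 ->
            Cmod (G s i - G s j) <= L ^ 2 * Cmod (gamma i - gamma j)).
  { intros s i j Hs. unfold G. eapply Rle_trans; [apply Hg|].
    (* The common target cancels, so the contraction only shrinks differences; [h] and [g]
       contribute one factor [L] each. *)
    replace (H s i + o - (H s j + o))%C
      with (RtoC (1 - s) * (h (gamma i) - h (gamma j)))%C by (unfold H; ring).
    rewrite Cmod_mult, Cmod_R, Rabs_pos_eq by lra.
    destruct (Hbi (gamma i) (gamma j)) as [_ C2].
    pose proof (Cmod_ge_0 (h (gamma i) - h (gamma j))).
    replace (L ^ 2 * Cmod (gamma i - gamma j))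
      with (L * (L * Cmod (gamma i - gamma j))) by ring.
    apply Rmult_le_compat_l; [lra|]. nra. }
  assert (Hlip : forall i s r', Cmod (G r' i - G s i)
            <= L * Cmod (h (gamma i) - o + RtoC m * u) * Rabs (r' - s)).
  { intros i s r'. unfold G. eapply Rle_trans; [apply Hg|].
    replace (H r' i + o - (H s i + o))%C
      with (- (RtoC (r' - s) * (h (gamma i) - o + RtoC m * u)))%C
      by (unfold H; rewrite !RtoC_minus, !RtoC_mult; ring).
    rewrite Cmod_opp, Cmod_mult, Cmod_R. lra. }
  destruct (endpoints_apart G N) as [s [Hs Hapart]].
  - intros i s _. apply (Cmod_lipschitz_components (fun q => G q i) _ s (Hlip i s)).
  - intros i s _. apply (Cmod_lipschitz_components (fun q => G q i) _ s (Hlip i s)).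
  - intros i s Hs Hi. eapply Rlt_le_trans; [|apply (Hlow s i Hs); lia].
    eapply Rle_lt_trans; [apply Hdiff; exact Hs|].
    replace c with (L ^ 2 * (c / L ^ 2)) by (field; lra).
    apply Rmult_lt_compat_l; [exact HL2|].
    apply Huc; try (apply Htau; lia).
    unfold tau. rewrite S_INR.
    replace (t + (INR i + 1) * d - (t + INR i * d)) with d by ring.
    rewrite Rabs_pos_eq; lra.
  - rewrite <- HNd. apply total_turn_spiral with phi t; [lra|intros; apply Hphi; lra|].
    intros i. unfold G, H. rewrite Rminus_0_r, Rmult_0_l.
    replace (RtoC 1 * (h (gamma i) - o) - RtoC 0 * u + o)%C with (h (gamma i)) by ring.
    apply Hgh.
  (* At time 1 every point has reached [g (o - m * u)]. *)
  - apply total_turn_const. intros i j. unfold G, H.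
    rewrite Rminus_diag. f_equal. ring.
  (* Contradiction: [c] is at most the modulus of [G s 0], hence at most the endpoint gap, which is
     at most [L ^ 2 * (eta * r) <= c / 2]. *)
  - assert (B0 := Hlow s O Hs (Nat.le_0_l N)).
    assert (B1 := Hdiff s N O Hs).
    assert (B2 : Cmod (gamma N - gamma O) <= eta * r).
    { destruct (Hturn _ (Htau N (le_n N))) as [D1 D2].
      unfold gamma, spiral_point.
      replace (tau N) with (t + 2 * PI) in * by (unfold tau; lra).
      replace (tau O) with t by (unfold tau; simpl; ring). fold r.
      rewrite cos_plus, sin_plus, cos_2PI, sin_2PI.
      (* After a full turn the endpoints lie on one ray, so their gap is purely radial. *)
      replace (Cminus (phi (t + 2 * PI) * (cos t * 1 - sin t * 0),
                       phi (t + 2 * PI) * (sin t * 1 + cos t * 0)) (r * cos t, r * sin t))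
        with (Cmult (RtoC (phi (t + 2 * PI) - r)) (polar t))
        by (unfold polar, RtoC, Cmult, Cminus, Cplus, Copp; simpl; f_equal; ring).
      rewrite Cmod_mult, Cmod_R, Cmod_polar, Rabs_left1 by lra. lra. }
    assert (B3 : 16 * L ^ 2 * (L ^ 2 * (eta * r)) <= eps * r).
    { replace (16 * L ^ 2 * (L ^ 2 * (eta * r))) with (eta * (16 * L ^ 4) * r) by ring.
      apply Rmult_le_compat_r; lra. }
    assert (B4 : 16 * L ^ 2 * c = 2 * (eps * r)) by (unfold c; field; lra).
    assert (0 < eps * r) by nra.
    assert (B5 : c <= L ^ 2 * (eta * r)) by nra.
    nra.
Qed.
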